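(* There is an absolute constant $C$ such that the following holds. Let $\mathcal X$ be a space of examples and let $\mathcal H$ be a hypothesis class over $\mathcal X$ with VC dimension $d$. Then there exist a region query family $Q$ over $\mathcal X$ with VC dimension at most $6d$ and a learning algorithm $\mathcal A$ such that for every set $S\subseteq\mathcal X$ of $n$ examples and every true hypothesis $h^*\in\mathcal H$, if the labeling domain is $L=S$, then $\mathcal A$ makes at most $C\,d\log n$ (i.e. $O(d\log n)$) region queries from $Q$ and correctly labels every example in $S$.
   Context: Region-query model. $\mathcal X$ is a set (the example space). A hypothesis class $\mathcal H$ is a (nonempty) set of functions $h:\mathcal X\to\{\pm1\}$; its VC dimension is the usual one. An unknown target $h^*\in\mathcal H$ labels the examples. A region query is a pair $(T,z)$ with $T\subseteq\mathcal X$ and $z\in\{\pm1\}$. A region query family $Q$ is a set of region queries; $\mathrm{dom}(Q)=\{T : (T,z)\in Q \text{ for some } z\}$ and the VC dimension of $Q$ is the VC dimension of the set family $\mathrm{dom}(Q)\subseteq 2^{\mathcal X}$. $Q$ is fixed before the dataset $S$ is seen. Given a finite dataset $S\subseteq\mathcal X$ and a labeling domain $L$ with $S\subseteq L\subseteq\mathcal X$, the labeler answers a query $(T,z)$ with $q(T,z)=1$ if $h^*(x)=z$ for all $x\in T\cap L$ and $q(T,z)=0$ otherwise; if $T\cap L=\emptyset$ the answer may be arbitrary. A learner is given $\mathcal H$, $S$, $Q$ (not $h^*$), adaptively submits queries from $Q$, and finally outputs a label for each example of $S$. Convention: logarithms in asymptotic bounds are read as $\max\{1,\log(\cdot)\}$.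 *)

(* Defs.v *)
From mathcomp Require Import all_boot all_order all_algebra.
From mathcomp Require Import boolp classical_sets cardinality reals exp.

Set Implicit Arguments.
Unset Strict Implicit.
Unset Printing Implicit Defensive.

Local Open Scope classical_set_scope.
Local Open Scope card_scope.

(* [true] stands for the label +1 and [false] for the label -1. *)
Definition label : Type := bool.

Section VCDimension.
Variable X : Type.

Definition class_shatters (H : set (X -> label)) (A : set X) : Prop :=
  forall g : X -> label, exists2 h, H h & forall x, A x -> h x = g x.

Definition family_shatters (F : set (set X)) (A : set X) : Prop :=
  forall B : set X, B `<=` A -> exists2 T, F T & T `&` A = B.

(* Only finite sets A are inspected: if an infinite set is shattered, so are
   all its finite subsets, hence no bound d exists in that case either. *)
Definition class_VCdim_le (H : set (X -> label)) (d : nat) : Prop :=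
  forall (A : set X) (m : nat), A #= `I_m -> class_shatters H A -> (m <= d)%N.

Definition class_VCdim (H : set (X -> label)) (d : nat) : Prop :=
  class_VCdim_le H d /\ exists2 A : set X, A #= `I_d & class_shatters H A.

Definition family_VCdim_le (F : set (set X)) (d : nat) : Prop :=
  forall (A : set X) (m : nat), A #= `I_m -> family_shatters F A -> (m <= d)%N.

End VCDimension.

Section RegionQueries.
Variable X : Type.

Definition region_query : Type := (set X * label)%type.

Definition query_dom (Q : set region_query) : set (set X) :=
  [set T | exists z : label, Q (T, z)].

(* The answer is unconstrained when T does not meet L; as this is a relation
   and not a function of the query, such answers may even be inconsistent
   between two submissions of the same query. *)
Definition valid_answer (L : set X) (hstar : X -> label)
    (q : region_query) (a : bool) : Prop :=
  q.1 `&` L !=set0 ->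
  (a = true <-> forall x, (q.1 `&` L) x -> hstar x = q.2).

(* Adaptive strategies restricted to queries from Q: the continuation after a
   query depends on its answer. In [Output f], only the values of f on the
   dataset matter. *)
Inductive strategy (Q : set region_query) : Type :=
| Output (f : X -> label)
| Ask (q : region_query) (Qq : Q q) (next : bool -> strategy Q).

(* [run L hstar s m f]: with some sequence of valid answers, s submits exactly
   m queries and then outputs f. *)
Inductive run (Q : set region_query) (L : set X) (hstar : X -> label) :
    strategy Q -> nat -> (X -> label) -> Prop :=
| run_output f : run L hstar (Output Q f) 0 f
| run_ask q (Qq : Q q) next a m f :
    valid_answer L hstar q a -> run L hstar (next a) m f ->
    run L hstar (Ask Qq next) m.+1 f.

(* A learner is given the dataset S, but neither the target nor the labels. *)
Definition learner (Q : set region_query) : Type := set X -> strategy Q.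

End RegionQueries.

(* Main.v *)
(** Well-order X and query the sets {x <= p : h x = z} with h in H. Whether h*
    agrees with h on the prefix {x <= p} of S takes two queries, one for each z.
    The learner keeps the set V of labelings of S by H consistent with the
    answers; some prefix of some member of V is shared by between one and two
    thirds of V, so each such test removes at least a third of V. As V starts
    with at most (n + 1)^d elements (Sauer-Shelah), O(d log n) queries leave
    only the labeling by h*. *)

Require Import Defs.
From mathcomp Require Import all_boot all_order all_algebra finmap.
From mathcomp Require Import boolp classical_sets cardinality reals exp.
From mathcomp Require wochoice.
From mathcomp Require Import zify.

Set Implicit Arguments.
Unset Strict Implicit.
Unset Printing Implicit Defensive.

Import Order.TTheory GRing.Theory Num.Theory.
Local Open Scope classical_set_scope.
Local Open Scope card_scope.
Local Open Scope ring_scope.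

(** * Sorted enumerations and the Sauer-Shelah bound *)

Lemma card_eq_uniq_seq (X : choiceType) (s : seq X) :
  uniq s -> [set` s] #= `I_(size s).
Proof.
move=> s_uniq.
have -> : [set` s] = [set` [fset x in s]%fset].
  by apply/seteqP; split=> x /=; rewrite inE.
by apply/card_eq_fsetP; rewrite card_fseq undup_id.
Qed.

Lemma card_eq_sorted_seq (X : choiceType) (le : rel X) (A : set X) (n : nat) :
  total le -> A #= `I_n ->
  exists s : seq X, [/\ A = [set` s], size s = n, uniq s & sorted le s].
Proof.
move=> le_total An; have /finite_seqP[t def_A] : finite_set A.
  by apply/finite_setP; exists n.
have def_As : A = [set` sort le (undup t)].
  by rewrite def_A; apply/seteqP; split=> x /=; rewrite mem_sort mem_undup.
have s_uniq : uniq (sort le (undup t)) by rewrite sort_uniq undup_uniq.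
exists (sort le (undup t)); split=> //; last exact: sort_sorted.
apply/card_eq_II; rewrite -(card_eql (card_eq_uniq_seq s_uniq)).
by rewrite -def_As.
Qed.

(** Turns the region below a point into a prefix of [s]: in a sorted list without duplicates, [le]
    compares indices. *)
Lemma sorted_le_nth (X : eqType) (le : rel X) (s : seq X) (x0 x : X) (i : nat) :
  total le -> transitive le -> antisymmetric le -> sorted le s -> uniq s ->
  (i < size s)%N -> x \in s -> le x (nth x0 s i) = (x \in take i.+1 s).
Proof.
move=> le_total le_trans le_anti s_sorted s_uniq lt_is xs.
have le_refl : reflexive le by move=> y; rewrite -[le y y]orbb le_total.
have ps := mem_nth x0 lt_is; rewrite in_take //.
have idx := index_uniq x0 lt_is s_uniq.
case: (leqP (index x s) i) => [le_xi|lt_ix].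
  by apply/esym; rewrite ltnS le_xi (sorted_leq_index le_trans le_refl s_sorted) ?idx.
have le_px : le (nth x0 s i) x.
  by rewrite (sorted_ltn_index le_trans s_sorted) ?idx.
rewrite ltnS leqNgt lt_ix; apply/negP => le_xp.
have eq_xp : x = nth x0 s i by apply: le_anti; rewrite le_xp.
by move: lt_ix; rewrite eq_xp idx ltnn.
Qed.

(* Induction on [s]: the traces on [x :: s] are the traces on [s], each
   extended by one bit, plus an extra copy of those that extend both ways; the
   latter shatter no set of size [e.-1] since adding [x] gives one of size [e]. *)
Lemma sauer_shelah (X : choiceType) (s : seq X) (H : set (X -> label))
    (e : nat) :
  uniq s ->
  (forall t, subseq t s -> class_shatters H [set` t] -> (size t < e)%N) ->
  exists2 L : seq (seq label), forall h, H h -> map h s \in L &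
    (size L <= (0 < e) * (size s).+1 ^ e.-1)%N.
Proof.
elim: s H e => [|x s IHs] H [|e] s_uniq Hs.
(* With [e = 0] not even the empty set is shattered, so [H] is empty; hence the factor [(0 < e)]. *)
- exists [::] => // h Hh.
  by suff: (size (@nil X) < 0)%N by []; apply: Hs (sub0seq _) _ => g; exists h.
- by exists [:: [::]] => //=; rewrite exp1n.
- exists [::] => // h Hh.
  by suff: (size (@nil X) < 0)%N by []; apply: Hs (sub0seq _) _ => g; exists h.
case/andP: s_uniq => xNs s_uniq.
have [L0 L0P L0size] : exists2 L : seq (seq label),
    forall h, H h -> map h s \in L & (size L <= (size s).+1 ^ e)%N.
  have [t sub_ts|L LP] := IHs H e.+1 s_uniq; last by rewrite mul1n; exists L.
  by apply: Hs; apply: subseq_trans sub_ts (subseq_cons _ _).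
pose H2 := [set h : X -> label | forall b,
  exists2 h', H h' & h' x = b /\ map h' s = map h s].
have [t sub_ts shat_t|L2 L2P L2size] := IHs H2 e s_uniq; last first.
  (* [b t] extends [t] within [H] whenever [t] is a trace of [H]; the opposite bit does so only for
     traces of [H2]. *)
  pose b (t : seq label) := `[< exists2 h, H h & h x = true /\ map h s = t >].
  exists ([seq b t :: t | t <- L0] ++ [seq ~~ b t :: t | t <- L2]).
    move=> h Hh /=; rewrite mem_cat; have hL0 := L0P h Hh.
    have [hxb|hxb] := eqVneq (h x) (b (map h s)).
      by apply/orP; left; apply/mapP; exists (map h s) => //; rewrite -hxb.
    have {}hxb : h x = ~~ b (map h s) by case: (h x) (b _) hxb => [] [].
    apply/orP; right; apply/mapP; exists (map h s); last by rewrite -hxb.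
    apply: L2P => c; have [->|cN] := eqVneq c (h x); first by exists h.
    move: hxb cN; rewrite /b; case: asboolP => [yes ->|no hx]; first by case: c.
    by case: no; exists h.
  rewrite size_cat !size_map mul1n; apply: leq_trans (leq_add L0size L2size) _.
  case: e {Hs L0size L2size} => [|e] /=; first by rewrite !expn0 mul0n.
  rewrite mul1n !expnS -mulSnr leq_mul2l /=.
  by case: e => // e; rewrite leq_exp2r.
rewrite -ltnS; apply: (Hs (x :: t)).
  by rewrite /= eqxx.
move=> g; have [h H2h hg] := shat_t g; have [h' Hh' [h'x h's]] := H2h (g x).
exists h' => // y /=; rewrite inE => /predU1P[->//|yt].
have ys := mem_subseq sub_ts yt.
by rewrite -(hg y yt); move/eq_in_map: h's => ->.
Qed.

(** * The query family and its VC dimension *)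

Definition prefix_queries (X : Type) (le : rel X) (H : set (X -> label)) :
    set (region_query X) :=
  [set q | exists2 h, H h & exists p, q.1 = [set x | le x p /\ h x = q.2]].

(* A trace on [A] containing the top point of [A] does not see the prefix, so the
   rest of [A] is shattered by [H] together with its complements. Splitting the
   rest in two halves of size above [d], a labeling that no member of [H]
   realizes on the first half and no complement on the second is missed. *)
Lemma prefix_queries_VCdim_le (X : choiceType) (le : rel X)
    (H : set (X -> label)) (d : nat) :
  total le -> transitive le -> class_VCdim_le H d ->
  family_VCdim_le (query_dom (prefix_queries le H)) (2 * d).+2.
Proof.
move=> le_total le_trans Hd A m Am shat_A; rewrite leqNgt; apply/negP => lt_dm.
(* Sorting downwards puts the top point of [A] at the head. *)
have ge_total : total (fun x y => le y x) by move=> x y; apply: le_total.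
have [s [defA sz_s s_uniq s_sorted]] := card_eq_sorted_seq ge_total Am.
case: s => [|a s] in defA sz_s s_uniq s_sorted; first by rewrite -sz_s in lt_dm.
have le_sa y : y \in a :: s -> le y a.
  rewrite inE => /predU1P[->|ys]; first by rewrite -[le a a]orbb.
  have ge_trans : transitive (fun x y => le y x) by move=> ? ? ? ? /le_trans; apply.
  by have /allP/(_ y ys) := order_path_min ge_trans s_sorted.
move: s_uniq; rewrite cons_uniq => /andP[aNs s_uniq].
have {m Am sz_s lt_dm} lt_ds : (2 * d.+1 <= size s)%N.
  by move: lt_dm; rewrite -sz_s mulnS.
have unrealized t : uniq t -> (d < size t)%N ->
    exists g, ~ exists2 h, H h & forall x, x \in t -> h x = g x.
  move=> t_uniq lt_dt; apply: contrapT => /forallNP realized.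
  move: lt_dt; rewrite ltnNge (Hd _ _ (card_eq_uniq_seq t_uniq)) // => g.
  exact: contrapT (realized g).
have [g1 g1P] : exists g,
    ~ exists2 h, H h & forall x, x \in take d.+1 s -> h x = g x.
  apply: unrealized; first exact: take_uniq.
  by rewrite size_takel //; apply: leq_trans lt_ds; rewrite leq_pmull.
have [g2 g2P] : exists g,
    ~ exists2 h, H h & forall x, x \in drop d.+1 s -> h x = g x.
  apply: unrealized; first exact: drop_uniq.
  by rewrite size_drop leq_subRL ?addnn -?mul2n //; apply: leq_trans lt_ds; rewrite leq_pmull.
(* For [z = true], [h] would equal [g1] on the first half; for [z = false], the trace is the
   negation of [h], which would equal [g2] on the second. *)
pose g x := if x \in take d.+1 s then g1 x else ~~ g2 x.
have [] := shat_A [set x | x = a \/ x \in s /\ g x].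
  by rewrite defA => x /= [->|[xs _]]; rewrite inE ?eqxx // xs orbT.
move=> T [z [h Hh [p /= defT]]] defB.
have le_ap : le a p.
  have : (T `&` A) a by rewrite defB; left.
  by rewrite defT => -[[]].
have hz x : x \in s -> (h x == z) = g x.
  move=> xs; have xA : x \in a :: s by rewrite inE xs orbT.
  apply/eqP/idP => [hx|gx].
    have : (T `&` A) x.
      by rewrite defT defA; split=> //; split=> //; apply: le_trans (le_sa x xA) _.
    by rewrite defB => -[eq_xa|[]//]; rewrite -eq_xa xs in aNs.
  have : (T `&` A) x by rewrite defB; right.
  by rewrite defT => -[[]].
case: z => [] in hz defT.
- apply: g1P; exists h => // x xt.
  by have := hz x (mem_take xt); rewrite eqb_id /g xt.
- apply: g2P; exists h => // x xd; apply: negb_inj.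
  have := hz x (mem_drop xd); rewrite eqbF_neg /g ifN //; apply/negP => xt.
  move: s_uniq; rewrite -[s](cat_take_drop d.+1) cat_uniq.
  by case/and3P => _ /hasP[]; exists x.
Qed.

(** * Agreement tests and balanced prefixes *)

Lemma runE (X : Type) (Q : set (region_query X)) (L : set X)
    (hstar : X -> label) (st : strategy Q) (m : nat) (f : X -> label) :
  run L hstar st m f ->
  match st with
  | Output g => m = 0%N /\ f = g
  | @Ask _ _ q _ next => exists a m',
      [/\ m = m'.+1, valid_answer L hstar q a & run L hstar (next a) m' f]
  end.
Proof. by case=> // q Qq next a {}m {}f; exists a, m. Qed.

(* Regions missing the dataset are skipped: their answers carry no
   information. *)
Lemma ask_region (X : Type) (Q : set (region_query X)) (L : set X)
    (q : region_query X) (yes no : strategy Q) :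
  Q q -> exists st : strategy Q, forall hstar m f, run L hstar st m f ->
    exists2 m', (m <= m'.+1)%N &
    if `[< forall x, (q.1 `&` L) x -> hstar x = q.2 >]
    then run L hstar yes m' f else run L hstar no m' f.
Proof.
move=> Qq; have [L0|/set0P LN0] := eqVneq (q.1 `&` L) set0.
  exists yes => hstar m f runf; exists m => //.
  by case: asboolP => // -[] x; rewrite L0.
exists (Ask Qq (fun a => if a then yes else no)) => hstar m f.
move=> /runE[a [m' [-> ans runf]]]; exists m' => //.
have := ans LN0; case: asboolP => [all_z [_ ans1]|not_z [ans1 _]].
  by rewrite ans1 in runf.
by case: a runf ans ans1 => // _ _ /(_ erefl).
Qed.

(** Agreement below [p] means that [hstar] is constantly [z] where [h] is [z], for both [z]. The
    second query is submitted only if the first test succeeds; a region missing [L] succeeds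
    vacuously. *)
Lemma ask_agreement (X : Type) (le : rel X) (H : set (X -> label))
    (L : set X) (h : X -> label) (p : X)
    (yes no : strategy (prefix_queries le H)) :
  H h -> exists st : strategy (prefix_queries le H),
    forall hstar m f, run L hstar st m f ->
    exists2 m', (m <= m'.+2)%N &
    if `[< forall x, L x -> le x p -> hstar x = h x >]
    then run L hstar yes m' f else run L hstar no m' f.
Proof.
move=> Hh.
have Qz z : prefix_queries le H ([set x | le x p /\ h x = z], z).
  by exists h => //; exists p.
have [st1 st1P] := ask_region L yes no (Qz false).
have [st stP] := ask_region L st1 no (Qz true).
exists st => hstar m f /stP[m1 le_m]; case: asboolP => /= [pos|npos].
  move=> /st1P[m2 le_m1]; case: asboolP => /= [neg|nneg] runf.
    exists m2; first exact: leq_trans le_m _.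
    rewrite asboolT // => x Lx xp; case hx: (h x).
      by apply: pos.
    by apply: neg.
  exists m2; first exact: leq_trans le_m _.
  by rewrite asboolF // => agree; apply: nneg => x [[xp <-] Lx]; apply: agree.
move=> runf; exists m1; first exact: leq_trans le_m _.
by rewrite asboolF // => agree; apply: npos => x [[xp <-] Lx]; apply: agree.
Qed.

(* Follow at each step the majority value among the members agreeing so far:
   the number of survivors at most halves at each step and ends at one, so it
   cannot jump over the middle third. *)
Lemma balanced_prefix (n : nat) (V : seq (seq bool)) :
  uniq V -> all (fun v => size v == n) V -> (1 < size V)%N ->
  exists v i, [/\ v \in V, (i < n)%N &
    (size V <= 3 * count (fun w => take i.+1 w == take i.+1 v) V
            <= 2 * size V)%N].
Proof.
move=> V_uniq /allP V_size V_gt1; apply: contrapT => no_prefix.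
suff big i : (i <= n)%N -> exists2 v, v \in V &
    (2 * size V < 3 * count (fun w => take i w == take i v) V)%N.
  (* At [i = n] prefixes are whole words, so the count is 1, too small for two thirds of [V]. *)
  have [v vV] := big n (leqnn n); rewrite ltnNge => /negP; apply.
  rewrite (@eq_in_count _ _ (pred1 v)) => [|w wV].
    by rewrite count_uniq_mem // vV; lia.
  by rewrite /= !take_oversize ?(eqP (V_size _ _)).
elim: i => [_|i IHi lt_in].
  case: V {V_uniq V_size no_prefix} V_gt1 => // v V _; exists v.
    exact: mem_head.
  rewrite (eq_count (a2 := predT)) => [|w]; last by rewrite /= !take0 eqxx.
  by rewrite count_predT /=; lia.
have [v vV big_v] := IHi (ltnW lt_in).
pose S := [seq w <- V | take i w == take i v].
have sumS : (count (fun w => nth false w i == true) S +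
             count (fun w => nth false w i == false) S = size S)%N.
  rewrite -[RHS](count_predC (fun w => nth false w i == true)); congr addn.
  by apply: eq_count => w /=; case: nth.
have big_S : (2 * size V < 3 * size S)%N by rewrite size_filter.
have [b half_b] : exists b, (size S <= 2 * count (fun w => nth false w i == b) S)%N.
  have [le_c|lt_c] := leqP (size S) (2 * count (fun w => nth false w i == true) S).
    by exists true.
  by exists false; lia.
have /hasP[v'] : has (fun w => nth false w i == b) S.
  by rewrite has_count; lia.
rewrite mem_filter => /andP[/eqP v'v v'V] /eqP v'b.
have countS : count (fun w => take i.+1 w == take i.+1 v') V =
              count (fun w => nth false w i == b) S.
  rewrite count_filter; apply: eq_in_count => w wV /=.
  rewrite !(take_nth false) ?(eqP (V_size _ _)) // eqseq_rcons v'v v'b.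
  by rewrite andbC.
exists v' => //; rewrite ltnNge; apply/negP => small.
by apply: no_prefix; exists v', i; split=> //; rewrite small countS; lia.
Qed.

(** * The halving learner *)

(** The condition on [k] says that [k] cuts by a factor 2/3 leave fewer than two candidates; each
    cut costs at most two queries. *)
Lemma halving_strategy (X : choiceType) (le : rel X) (H : set (X -> label))
    (s : seq X) :
  total le -> transitive le -> antisymmetric le -> sorted le s -> uniq s ->
  forall (k : nat) (V : seq (seq label)),
  uniq V -> (forall v, v \in V -> exists2 h, H h & v = map h s) ->
  (size V * 2 ^ k < 2 * 3 ^ k)%N ->
  exists st : strategy (prefix_queries le H), forall hstar m f,
    map hstar s \in V -> run [set` s] hstar st m f ->
    (m <= 2 * k)%N /\ {in s, f =1 hstar}.
Proof.
move=> le_total le_trans le_anti s_sorted s_uniq.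
have small k (V : seq (seq label)) : (size V <= 1)%N ->
    (forall v, v \in V -> exists2 h, H h & v = map h s) ->
    exists st : strategy (prefix_queries le H), forall hstar m f,
    map hstar s \in V -> run [set` s] hstar st m f ->
    (m <= 2 * k)%N /\ {in s, f =1 hstar}.
  case: V => [|v [|//]] _ HV; first by exists (Output _ (fun=> true)).
  have [h _ def_v] := HV v (mem_head _ _).
  exists (Output _ h) => hstar m f; rewrite inE def_v => /eqP/eq_in_map eq_h.
  by move=> /runE[-> ->]; split=> // x xs; rewrite eq_h.
elim=> [|k IHk] V V_uniq HV V_size.
  by apply: small HV; move: V_size; rewrite !expn0; lia.
have [V_le1|V_gt1] := leqP (size V) 1; first exact: small V_le1 HV.
have sizeV : all (fun v => size v == size s) V.
  by apply/allP => v /HV[h _ ->]; rewrite size_map.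
have [v [i [vV lt_is /andP[lb ub]]]] := balanced_prefix V_uniq sizeV V_gt1.
have [h Hh def_v] := HV v vV.
pose a (w : seq label) := take i.+1 w == take i.+1 v.
(* Only a default for [nth], as [i] is in range. *)
have x0 : X by case: (s) lt_is.
have IHf (b : pred (seq label)) : (3 * count b V <= 2 * size V)%N ->
    exists st : strategy (prefix_queries le H), forall hstar m f,
    map hstar s \in filter b V -> run [set` s] hstar st m f ->
    (m <= 2 * k)%N /\ {in s, f =1 hstar}.
  move=> le_b; apply: IHk; first exact: filter_uniq.
    by move=> w; rewrite mem_filter => /andP[_ /HV].
  by rewrite size_filter; move: V_size; rewrite !expnS; nia.
have [yes yesP] := IHf a ub.
have [|no noP] := IHf (predC a).
  have sumV : (count a V + count (predC a) V = size V)%N by exact: count_predC.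
  have : (size V <= 3 * count a V)%N by [].
  by move: sumV; clear; lia.
have [st stP] := ask_agreement [set` s] (nth x0 s i) yes no Hh.
exists st => hstar m f hV /stP[m' le_m].
(* The region includes its endpoint, at index [i], so it meets [s] in the first [i.+1] points. *)
have -> : `[< forall x, [set` s] x -> le x (nth x0 s i) -> hstar x = h x >]
          = a (map hstar s).
  rewrite /a def_v -!map_take; apply/asboolP/eqP => [agree|/eq_in_map agree x xs].
    apply/eq_in_map => x xt; have xs := mem_take xt.
    by apply: agree => //; rewrite (sorted_le_nth x0).
  by rewrite (sorted_le_nth x0) //; apply: agree.
case: ifP => ah.
  by move=> /(yesP hstar)[|le_m' eq_f]; [rewrite mem_filter ah|split=> //; lia].
by move=> /(noP hstar)[|le_m' eq_f]; [rewrite mem_filter /= ah|split=> //; lia].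
Qed.

(** * Counting traces, the logarithm and the order *)

(** The Sauer-Shelah list only covers the traces; filtering it ensures that each candidate comes
    from some [h] in [H] to query with. *)
Lemma class_traces (X : choiceType) (H : set (X -> label)) (d : nat)
    (s : seq X) :
  class_VCdim_le H d -> uniq s -> exists V : seq (seq label),
    [/\ uniq V, (size V <= (size s).+1 ^ d)%N &
        forall v, v \in V <-> exists2 h, H h & v = map h s].
Proof.
move=> Hd s_uniq; have [t sub_ts shat_t|L LP L_size] := @sauer_shelah X s H d.+1 s_uniq.
  by rewrite ltnS; apply: Hd shat_t; apply/card_eq_uniq_seq/(subseq_uniq sub_ts).
rewrite mul1n in L_size.
exists (undup [seq v <- L | `[< exists2 h, H h & v = map h s >]]); split.
- exact: undup_uniq.
- apply: leq_trans (size_undup _) (leq_trans _ L_size).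
  by rewrite size_filter count_size.
- move=> v; rewrite mem_undup mem_filter; split=> [/andP[/asboolP]//|Hv].
  by apply/andP; split; [apply/asboolP|have [h Hh ->] := Hv; apply: LP].
Qed.

(** Two hypotheses that differ at [x] shatter [{x}]. *)
Lemma class_VCdim_le0 (X : Type) (H : set (X -> label)) (h h' : X -> label) :
  class_VCdim_le H 0 -> H h -> H h' -> h = h'.
Proof.
move=> H0 Hh Hh'; apply: funext => x; have [//|neq_x] := eqVneq (h x) (h' x).
suff : (1 <= 0)%N by [].
apply: H0 (card_set1 (x := x)) _ => g.
exists (if g x == h x then h else h'); first by case: ifP.
move=> y ->; have [//|] := eqVneq (g x) (h x).
by case: (g x) (h x) (h' x) neq_x => [] [] [].
Qed.

(** The successor is absorbed by the 1 in the maximum, and [(ln 2)^-1] changes the base. *)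
Lemma trunc_log2_le_ln (R : realType) (n : nat) :
  (trunc_log 2 n).+1%:R <= (1 + (ln 2)^-1) * Num.max 1 (ln n%:R) :> R.
Proof.
have ln2_gt0 : 0 < ln 2 :> R by rewrite ln_gt0 // ltr1n.
set M := Num.max _ _; have M_ge1 : 1 <= M by rewrite /M le_max lexx.
have M_geln : ln n%:R <= M by rewrite /M le_max lexx orbT.
rewrite mulrDl mul1r -natr1 addrC lerD //.
rewrite ler_pdivlMl //; case: n => [|n] in M M_ge1 M_geln *.
  by rewrite trunc_log0 mulr0; apply: le_trans M_ge1.
apply: le_trans M_geln; rewrite mulr_natr -lnXn ?ltr0n //.
by rewrite ler_ln ?posrE ?exprn_gt0 ?ltr0n // -natrX ler_nat trunc_logP.
Qed.

Lemma exists_total_order (X : eqType) :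
  exists le : rel X, [/\ total le, transitive le & antisymmetric le].
Proof.
have [le le_wo] := wochoice.well_ordering_principle X; exists le.
have chain : wochoice.wo_chain le predT by move=> A _; apply: le_wo.
have le_anti : antisymmetric le.
  by move=> x y; apply: (wochoice.wo_chain_antisymmetric chain).
split=> //; first by move=> x y; apply: (wochoice.wo_chainW chain).
move=> y x z xy yz.
(* Transitivity comes from the least of the three points: unless it is [x], antisymmetry identifies
   two of them. *)
have [|w [[w_in w_min] _]] := le_wo (mem [:: x; y; z]).
  by exists x; apply: mem_head.
have [wx wy wz] : [/\ le w x, le w y & le w z].
  by split; apply: w_min; rewrite !inE eqxx ?orbT.
move: w_in; rewrite !inE => /or3P[] /eqP def_w; subst w => //.
  by have -> : x = y by apply: le_anti; rewrite xy wx.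
by have -> : z = y by apply: le_anti; rewrite yz wy.
Qed.

Theorem theorem1p2 (R : realType) :
  exists C : R,
  forall (X : Type) (H : set (X -> label)) (d : nat),
  H !=set0 -> class_VCdim H d ->
  exists Q : set (region_query X),
    family_VCdim_le (query_dom Q) (6 * d)%N /\
    exists A : learner Q,
      forall (n : nat) (S : set X) (hstar : X -> label),
      S #= `I_n -> H hstar ->
      forall (m : nat) (f : X -> label), run S hstar (A S) m f ->
        m%:R <= C * d%:R * Num.max 1 (ln n%:R) /\
        (forall x, S x -> f x = hstar x).
Proof.
(* 4 is two queries per round times the 2 in the number of rounds; the other factor converts the
   logarithm. *)
exists (4%:R * (1 + (ln 2)^-1)) => X.
elim/Pchoice: X => X H d [h0 Hh0] [Hd _].
(* Dimension 0 is separate: no query is allowed, and [2 * d + 2 <= 6 * d] fails. *)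
case: d Hd => [|d] Hd.
  exists set0; split.
    move=> A m Am /(_ set0) [|T [z []]]; exact: sub0set.
  exists (fun=> Output _ h0) => n S hstar _ Hhstar m f /runE[-> ->].
  by rewrite mulr0 mul0r (class_VCdim_le0 Hd Hh0 Hhstar).
have [le [le_total le_trans le_anti]] := exists_total_order X.
exists (prefix_queries le H); split.
  move=> A m Am shat_A.
  by have := prefix_queries_VCdim_le le_total le_trans Hd Am shat_A; lia.
(* The strategy may depend on [S] alone, so [hstar] is quantified inside. *)
pose good (S : set X) (st : strategy (prefix_queries le H)) :=
  forall n hstar, S #= `I_n -> H hstar -> forall m f, run S hstar st m f ->
    (m <= 4 * d.+1 * (trunc_log 2 n).+1)%N /\ (forall x, S x -> f x = hstar x).
have /choice[A A_good] : forall S, exists st, good S st.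
  move=> S; have [/finite_setP[n Sn]|S_inf] := pselect (finite_set S); last first.
    exists (Output _ h0) => n hstar Sn; case: S_inf; apply/finite_setP.
    by exists n.
  have [s [defS sz_s s_uniq s_sorted]] := card_eq_sorted_seq le_total Sn.
  have [V [V_uniq V_size VP]] := class_traces Hd s_uniq.
  have V_traces v : v \in V -> exists2 h, H h & v = map h s by move/VP.
  (* With [u = t * d.+1], [V] has at most [2 ^ u] elements, and [2 * u] rounds suffice as
     [2 ^ u * 4 ^ u = 8 ^ u <= 9 ^ u]. *)
  have V_small : (size V * 2 ^ (2 * d.+1 * (trunc_log 2 n).+1)
                  < 2 * 3 ^ (2 * d.+1 * (trunc_log 2 n).+1))%N.
    have lt_n : (n < 2 ^ (trunc_log 2 n).+1)%N by apply: trunc_log_ltn.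
    set t := (trunc_log 2 n).+1 in lt_n *.
    have V_le : (size V <= 2 ^ (t * d.+1))%N.
      by apply: leq_trans V_size _; rewrite sz_s expnM leq_exp2r.
    have -> : (2 * d.+1 * t = 2 * (t * d.+1))%N by lia.
    move: (t * d.+1)%N V_le => u V_le.
    rewrite !expnM; apply: leq_ltn_trans (leq_mul V_le (leqnn _)) _.
    rewrite -expnMn; apply: (@leq_ltn_trans (9 ^ u)); last first.
      by rewrite ltn_Pmull ?expn_gt0.
    by case: u {V_le} => // u; rewrite leq_exp2r.
  have [st stP] := halving_strategy le_total le_trans le_anti s_sorted s_uniq
    V_uniq V_traces V_small.
  exists st => n' hstar Sn' Hhstar m f; rewrite defS => runf.
  have -> : n' = n.
    by apply/card_eq_II; rewrite -(card_eql Sn').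
  have [|le_m eq_f] := stP hstar m f _ runf; first by apply/VP; exists hstar.
  by split=> //; apply: leq_trans le_m _; rewrite !mulnA.
exists A => n S hstar Sn Hhstar m f runf.
have [le_m eq_f] := A_good S n hstar Sn Hhstar m f runf; split=> //.
move: le_m; rewrite -(ler_nat R) => /Order.POrderTheory.le_trans; apply.
rewrite natrM natrM -!mulrA ler_pM2l ?ltr0n // mulrCA ler_pM2l ?ltr0n //.
exact: trunc_log2_le_ln.
Qed.
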